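(* The space $$c_0=\Big\{x=\{\alpha_n\}_{n=0}^{\infty}\subset\mathbb{C}:\ \lim_{n\to\infty}\alpha_n=0\Big\}$$ (with the supremum norm) is a Banach space with uniform multiplicity infinity of infinite index.
   Context: $\mathcal{B}(X)$ is the set of bounded linear operators on a complex Banach space $X$. A system of matrix units of $\mathcal{B}(X)$ is a family $\{u_{j,k}\}_{j,k=0}^{\infty}\subset\mathcal{B}(X)$ such that (a) $\sup\{\|u_{j,k}\|:j,k\ge 0\}<\infty$; (b) $u_{j,k}u_{l,m}=\delta_{kl}u_{j,m}$ for all $j,k,l,m$ (Kronecker delta); (c) $x=\sum_{k=0}^{\infty}u_{k,k}x$ for every $x\in X$, with convergence in norm. An infinite-dimensional Banach space $X$ has uniform multiplicity infinity of infinite index if there is a system of matrix units $\{u_{j,k}\}_{j,k=0}^\infty$ of $\mathcal{B}(X)$ with $\dim\operatorname{Ran}u_{0,0}=\infty$. *)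

(* Defs.v *)
From Stdlib Require Import Reals Lra Lia.
From Stdlib Require Import ProofIrrelevance FunctionalExtensionality.
From Stdlib Require Import PropExtensionality ClassicalEpsilon.
From Coquelicot Require Import Coquelicot.

Local Open Scope R_scope.

(** Coquelicot's [is_linear] includes the estimate [norm (T x) <= M * norm x],
    so it is exactly membership in the bounded linear operators. *)
Definition bounded_operator {X : NormedModule C_AbsRing} (T : X -> X) : Prop :=
  is_linear T.

(** The supremum is finite when [T] is a bounded operator; otherwise [real]
    may return a meaningless value. *)
Definition operator_norm {X : NormedModule C_AbsRing} (T : X -> X) : R :=
  real (Lub_Rbar (fun r => exists x : X, norm x <= 1 /\ r = norm (T x))).

Definition range {X Y : Type} (T : X -> Y) : Y -> Prop :=
  fun y => exists x, y = T x.

(** [S] is meant to be a linear subspace; [sum_n] has [n + 1] terms, and the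
    zero subspace is covered by [n = 0], [e 0 = zero]. *)
Definition finite_dimensional {X : NormedModule C_AbsRing} (S : X -> Prop)
    : Prop :=
  exists (n : nat) (e : nat -> X),
    (forall i : nat, (i <= n)%nat -> S (e i)) /\
    (forall x : X, S x ->
       exists a : nat -> C, x = sum_n (fun i => scal (a i) (e i)) n).

Definition infinite_dimensional {X : NormedModule C_AbsRing} (S : X -> Prop)
    : Prop :=
  ~ finite_dimensional S.

Record matrix_units (X : CompleteNormedModule C_AbsRing)
    (u : nat -> nat -> X -> X) : Prop := {
  mu_operator : forall j k : nat, bounded_operator (u j k);
  mu_bounded : bound (fun r : R => exists j k : nat, r = operator_norm (u j k));
  mu_mult : forall (j k l m : nat) (x : X),
    u j k (u l m x) = if Nat.eqb k l then u j m x else zero;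
  mu_sum : forall x : X, is_series (fun k : nat => u k k x) x
}.

Definition uniform_multiplicity_infinity_infinite_index
    (X : CompleteNormedModule C_AbsRing) : Prop :=
  infinite_dimensional (fun _ : X => True) /\
  exists u : nat -> nat -> X -> X,
    matrix_units X u /\ infinite_dimensional (range (u 0%nat 0%nat)).

Record c0 : Type := mk_c0 {
  c0_seq :> nat -> C;
  c0_cvg : filterlim c0_seq eventually (locally (RtoC 0))
}.

Definition c0_norm (x : c0) : R :=
  real (Sup_seq (fun n : nat => Finite (Cmod (x n)))).

Lemma c0_ext (x y : c0) : (forall n, x n = y n) -> x = y.
Proof.
  destruct x as [x hx], y as [y hy]; simpl; intros H.
  assert (E : x = y) by (apply functional_extensionality; exact H).
  subst y; f_equal; apply proof_irrelevance.
Qed.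

Lemma cvg0_Cmod (x : nat -> C) :
  filterlim x eventually (locally (RtoC 0)) <->
  (forall eps : posreal, exists N, forall n, (N <= n)%nat -> Cmod (x n) < eps).
Proof.
  split.
  - intros H eps.
    assert (L : locally (RtoC 0) (fun y : C => Cmod y < eps)).
    { apply (locally_le_locally_norm (V := C_NormedModule) (RtoC 0)).
      exists eps; intros y Hy; unfold ball_norm in Hy.
      replace y with (Cminus y (RtoC 0)) by ring; exact Hy. }
    destruct (H _ L) as [N HN]; exists N; exact HN.
  - intros H P HP.
    apply (locally_norm_le_locally (V := C_NormedModule) (RtoC 0)) in HP.
    destruct HP as [eps HP]; destruct (H eps) as [N HN].
    exists N; intros n Hn; apply HP; unfold ball_norm.
    change (Cmod (Cminus (x n) (RtoC 0)) < eps).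
    replace (Cminus (x n) (RtoC 0)) with (x n) by ring; exact (HN n Hn).
Qed.

Lemma c0_norm_spec (x : c0) :
  (forall n, Cmod (x n) <= c0_norm x) /\
  (forall M, (forall n, Cmod (x n) <= M) -> c0_norm x <= M).
Proof.
  assert (B : exists M, forall n, Cmod (x n) <= M).
  { destruct (proj1 (cvg0_Cmod x) (c0_cvg x) (mkposreal 1 Rlt_0_1)) as [N HN].
    simpl in HN.
    assert (F : forall k, exists M, forall n, (n < k)%nat -> Cmod (x n) <= M).
    { induction k as [|k [M HM]].
      - exists 0; intros; lia.
      - exists (Rmax M (Cmod (x k))); intros n Hn.
        destruct (Nat.eq_dec n k) as [->|Hne]; [apply Rmax_r|].
        apply Rle_trans with M; [apply HM; lia|apply Rmax_l]. }
    destruct (F N) as [M HM]; exists (Rmax M 1); intros n.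
    destruct (Nat.lt_ge_cases n N) as [Hn|Hn].
    - apply Rle_trans with M; [apply HM; lia|apply Rmax_l].
    - apply Rle_trans with 1; [left; apply HN; lia|apply Rmax_r]. }
  unfold c0_norm, Sup_seq.
  destruct (ex_sup_seq (fun n => Finite (Cmod (x n)))) as [l Hl]; simpl.
  apply is_sup_seq_lub in Hl; destruct Hl as [Hub Hlub].
  assert (up : forall M, (forall n, Cmod (x n) <= M) -> Rbar_le l (Finite M)).
  { intros M HM; apply Hlub; intros r [n ->]; exact (HM n). }
  assert (lo : forall n, Rbar_le (Finite (Cmod (x n))) l).
  { intros n; apply Hub; exists n; reflexivity. }
  destruct l as [l| |].
  - split; [exact lo|exact up].
  - destruct B as [M HM]; destruct (up M HM).
  - destruct (lo 0%nat).
Qed.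

Definition c0_norm_ge (x : c0) : forall n, Cmod (x n) <= c0_norm x :=
  proj1 (c0_norm_spec x).

Definition c0_norm_le (x : c0) :
    forall M, (forall n, Cmod (x n) <= M) -> c0_norm x <= M :=
  proj2 (c0_norm_spec x).

Lemma c0_norm_ge0 (x : c0) : 0 <= c0_norm x.
Proof. apply Rle_trans with (2 := c0_norm_ge x 0); apply Cmod_ge_0. Qed.

Lemma c0_zero_cvg : filterlim (fun _ : nat => RtoC 0) eventually (locally (RtoC 0)).
Proof. apply filterlim_const. Qed.

Lemma c0_plus_cvg (x y : c0) :
  filterlim (fun n => Cplus (x n) (y n)) eventually (locally (RtoC 0)).
Proof.
  apply cvg0_Cmod; intros eps.
  destruct (proj1 (cvg0_Cmod x) (c0_cvg x) (pos_div_2 eps)) as [N HN].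
  destruct (proj1 (cvg0_Cmod y) (c0_cvg y) (pos_div_2 eps)) as [N' HN'].
  exists (N + N')%nat; intros n Hn.
  specialize (HN n ltac:(lia)); specialize (HN' n ltac:(lia)); simpl in *.
  pose proof (Cmod_triangle (x n) (y n)); lra.
Qed.

Lemma c0_opp_cvg (x : c0) :
  filterlim (fun n => Copp (x n)) eventually (locally (RtoC 0)).
Proof.
  apply cvg0_Cmod; intros eps.
  destruct (proj1 (cvg0_Cmod x) (c0_cvg x) eps) as [N HN].
  exists N; intros n Hn; rewrite Cmod_opp; exact (HN n Hn).
Qed.

Lemma c0_scal_cvg (a : C) (x : c0) :
  filterlim (fun n => Cmult a (x n)) eventually (locally (RtoC 0)).
Proof.
  apply cvg0_Cmod; intros eps.
  assert (P : 0 < Cmod a + 1) by (pose proof (Cmod_ge_0 a); lra).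
  destruct (proj1 (cvg0_Cmod x) (c0_cvg x)
              (mkposreal _ (Rdiv_lt_0_compat _ _ (cond_pos eps) P)))
    as [N HN]; simpl in HN.
  exists N; intros n Hn; specialize (HN n Hn); rewrite Cmod_mult.
  apply Rle_lt_trans with ((Cmod a + 1) * Cmod (x n)).
  - apply Rmult_le_compat_r; [apply Cmod_ge_0|lra].
  - apply Rlt_le_trans with ((Cmod a + 1) * (eps / (Cmod a + 1))).
    + apply Rmult_lt_compat_l; assumption.
    + right; field; lra.
Qed.

Definition c0_zero : c0 := mk_c0 _ c0_zero_cvg.
Definition c0_plus (x y : c0) : c0 := mk_c0 _ (c0_plus_cvg x y).
Definition c0_opp (x : c0) : c0 := mk_c0 _ (c0_opp_cvg x).
Definition c0_scal (a : C) (x : c0) : c0 := mk_c0 _ (c0_scal_cvg a x).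

Definition c0_AbelianMonoid_mixin : AbelianMonoid.mixin_of c0.
Proof.
  apply (AbelianMonoid.Mixin c0 c0_plus c0_zero);
    intros; apply c0_ext; intros n; simpl; ring.
Defined.

Canonical c0_AbelianMonoid : AbelianMonoid :=
  AbelianMonoid.Pack c0 c0_AbelianMonoid_mixin c0.

Definition c0_AbelianGroup_mixin : AbelianGroup.mixin_of c0_AbelianMonoid.
Proof.
  apply (AbelianGroup.Mixin c0_AbelianMonoid c0_opp).
  intros; apply c0_ext; intros n; simpl; ring.
Defined.

Canonical c0_AbelianGroup : AbelianGroup :=
  AbelianGroup.Pack c0
    (AbelianGroup.Class c0 c0_AbelianMonoid_mixin c0_AbelianGroup_mixin) c0.

Definition c0_ModuleSpace_mixin : ModuleSpace.mixin_of C_Ring c0_AbelianGroup.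
Proof.
  apply (ModuleSpace.Mixin C_Ring c0_AbelianGroup c0_scal);
    intros; apply c0_ext; intros n; unfold mult, one, plus; simpl; ring.
Defined.

Canonical c0_ModuleSpace : ModuleSpace C_Ring :=
  ModuleSpace.Pack C_Ring c0
    (ModuleSpace.Class C_Ring c0 (AbelianGroup.class c0_AbelianGroup)
       c0_ModuleSpace_mixin) c0.

Lemma c0_norm_plus (x y : c0) : c0_norm (plus x y) <= c0_norm x + c0_norm y.
Proof.
  apply c0_norm_le; intros n; simpl.
  pose proof (Cmod_triangle (x n) (y n)).
  pose proof (c0_norm_ge x n); pose proof (c0_norm_ge y n); lra.
Qed.

Lemma c0_norm_scal (a : C) (x : c0) :
  c0_norm (scal a x) <= Cmod a * c0_norm x.
Proof.
  apply c0_norm_le; intros n; simpl; rewrite Cmod_mult.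
  apply Rmult_le_compat_l; [apply Cmod_ge_0|apply c0_norm_ge].
Qed.

Lemma c0_norm_eq0 (x : c0) : c0_norm x = 0 -> x = zero.
Proof.
  intros H; apply c0_ext; intros n; simpl; apply Cmod_eq_0.
  pose proof (c0_norm_ge x n); pose proof (Cmod_ge_0 (x n)); lra.
Qed.

Lemma c0_norm_zero : c0_norm zero = 0.
Proof.
  apply Rle_antisym; [|apply c0_norm_ge0].
  apply c0_norm_le; intros n; simpl; rewrite Cmod_0; lra.
Qed.

Definition c0_ball (x : c0) (eps : R) (y : c0) : Prop :=
  c0_norm (minus y x) < eps.

Definition c0_UniformSpace_mixin : UniformSpace.mixin_of c0.
Proof.
  apply (UniformSpace.Mixin c0 c0_zero c0_ball); unfold c0_ball.
  - intros x e; rewrite minus_eq_zero.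
    change (c0_norm zero < e); rewrite c0_norm_zero; apply cond_pos.
  - intros x y e; apply Rle_lt_trans.
    apply c0_norm_le; intros n.
    replace (Cmod (minus x y n)) with (Cmod (minus y x n)).
    + apply c0_norm_ge.
    + simpl; rewrite <- Cmod_opp; f_equal; ring.
  - intros x y z e1 e2 H1 H2.
    apply Rle_lt_trans with (c0_norm (plus (minus z y) (minus y x))).
    + right; f_equal; apply minus_trans.
    + apply Rle_lt_trans with (1 := c0_norm_plus (minus z y) (minus y x)).
      rewrite Rplus_comm; apply Rplus_lt_compat; assumption.
Defined.

Canonical c0_UniformSpace : UniformSpace :=
  UniformSpace.Pack c0 c0_UniformSpace_mixin c0.

Canonical c0_NormedModuleAux : NormedModuleAux C_AbsRing :=
  NormedModuleAux.Pack C_AbsRing c0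
    (NormedModuleAux.Class C_AbsRing c0 (ModuleSpace.class C_Ring c0_ModuleSpace)
       c0_UniformSpace_mixin) c0.

Definition c0_NormedModule_mixin :
  NormedModule.mixin_of C_AbsRing c0_NormedModuleAux.
Proof.
  apply (NormedModule.Mixin C_AbsRing c0_NormedModuleAux c0_norm 1).
  - exact c0_norm_plus.
  - exact c0_norm_scal.
  - intros x y eps H; exact H.
  - intros x y eps H; rewrite Rmult_1_l; exact H.
  - exact c0_norm_eq0.
Defined.

Canonical c0_NormedModule : NormedModule C_AbsRing :=
  NormedModule.Pack C_AbsRing c0
    (NormedModule.Class C_AbsRing c0
       (NormedModuleAux.class C_AbsRing c0_NormedModuleAux)
       c0_NormedModule_mixin) c0.

Lemma c0_complete (F : (c0 -> Prop) -> Prop) :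
  ProperFilter F -> cauchy F ->
  exists l : c0, forall eps : posreal, F (ball l eps).
Proof.
  intros PF CF.
  assert (FF := filter_filter : Filter F).
  pose (G := fun n (P : C -> Prop) => F (fun x : c0 => P (x n))).
  assert (PG : forall n, ProperFilter (G n)).
  { intros n; exact (filtermap_proper_filter _ _ (fun x : c0 => x n) F PF). }
  assert (close_coord : forall (x y : c0) (e : R), ball x e y ->
            forall n, Cmod (Cminus (y n) (x n)) < e).
  { intros x y e H n; apply Rle_lt_trans with (2 := H).
    exact (c0_norm_ge (minus y x) n). }
  assert (CG : forall n, cauchy (G n)).
  { intros n eps; destruct (CF eps) as [x Hx]; exists (x n).
    unfold G; revert Hx; apply filter_imp; intros y Hy.
    apply (norm_compat1 (V := C_NormedModule)).
    exact (close_coord _ _ _ Hy n). }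
  pose (l := fun n => lim (T := C_CompleteNormedModule) (G n) : C).
  assert (Hl : forall n (e : posreal),
            F (fun x : c0 => Cmod (Cminus (x n) (l n)) < e)).
  { intros n e.
    pose proof (complete_cauchy (T := C_CompleteNormedModule)
                  (G n) (PG n) (CG n)) as L.
    assert (Lo : locally (l n) (fun z : C => Cmod (Cminus z (l n)) < e)).
    { apply (locally_le_locally_norm (V := C_NormedModule) (l n)).
      exists e; intros y Hy; exact Hy. }
    destruct Lo as [d Hd].
    specialize (L d); unfold G in L; revert L; apply filter_imp.
    intros x Hx; apply Hd; exact Hx. }
  assert (Unif : forall (e : posreal),
            exists x : c0, F (ball x e) /\
              forall n, Cmod (Cminus (x n) (l n)) <= e).
  { intros e; destruct (CF e) as [x Hx]; exists x; split; [exact Hx|].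
    intros n; apply le_epsilon; intros d Hd.
    pose proof (filter_and _ _ Hx (Hl n (mkposreal d Hd))) as H.
    destruct (filter_ex _ H) as [y [H1 H2]]; simpl in H2.
    pose proof (close_coord _ _ _ H1 n) as H3.
    replace (Cminus (x n) (l n))
      with (Cplus (Copp (Cminus (y n) (x n))) (Cminus (y n) (l n))) by ring.
    pose proof (Cmod_triangle (Copp (Cminus (y n) (x n))) (Cminus (y n) (l n))).
    rewrite Cmod_opp in H0; lra. }
  assert (cl : filterlim l eventually (locally (RtoC 0))).
  { apply cvg0_Cmod; intros eps.
    destruct (Unif (pos_div_2 eps)) as [x [_ Hx]]; simpl in Hx.
    destruct (proj1 (cvg0_Cmod x) (c0_cvg x) (pos_div_2 eps)) as [N HN].
    exists N; intros n Hn; specialize (HN n Hn); simpl in HN; specialize (Hx n).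
    replace (l n) with (Cplus (x n) (Copp (Cminus (x n) (l n)))) by ring.
    pose proof (Cmod_triangle (x n) (Copp (Cminus (x n) (l n)))) as T.
    rewrite Cmod_opp in T; lra. }
  exists (mk_c0 l cl); intros eps.
  assert (P : 0 < eps / 3) by (pose proof (cond_pos eps); lra).
  destruct (Unif (mkposreal _ P)) as [x [Hx Hxl]]; simpl in Hxl.
  revert Hx; apply filter_imp; intros y Hy.
  assert (c0_norm (minus y (mk_c0 l cl)) <= 2 * (eps / 3)).
  { apply c0_norm_le; intros n.
    change (Cmod (Cminus (y n) (l n)) <= 2 * (eps / 3)).
    pose proof (close_coord _ _ _ Hy n) as H; simpl in H; specialize (Hxl n).
    replace (Cminus (y n) (l n))
      with (Cplus (Cminus (y n) (x n)) (Cminus (x n) (l n))) by ring.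
    pose proof (Cmod_triangle (Cminus (y n) (x n)) (Cminus (x n) (l n))); lra. }
  change (c0_norm (minus y (mk_c0 l cl)) < eps); lra.
Qed.

Definition c0_filter_lim (F : (c0 -> Prop) -> Prop) : c0 :=
  epsilon (inhabits c0_zero) (fun l => forall eps : posreal, F (ball l eps)).

Definition c0_CompleteSpace_mixin : CompleteSpace.mixin_of c0_UniformSpace.
Proof.
  apply (CompleteSpace.Mixin c0_UniformSpace c0_filter_lim).
  - intros F PF CF; exact (epsilon_spec _ _ (c0_complete F PF CF)).
  - intros F1 F2 H12 H21.
    assert (E : F1 = F2).
    { apply functional_extensionality; intros P.
      apply propositional_extensionality; split; [apply H21|apply H12]. }
    rewrite E; intros eps; apply ball_center.
Defined.

Canonical c0_CompleteNormedModule : CompleteNormedModule C_AbsRing :=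
  CompleteNormedModule.Pack C_AbsRing c0
    (CompleteNormedModule.Class C_AbsRing c0
       (NormedModule.class C_AbsRing c0_NormedModule)
       c0_CompleteSpace_mixin) c0.

(* Main.v *)
From Stdlib Require Import Reals Lra Lia Cantor.
Require Import Defs.
From Coquelicot Require Import Coquelicot.

(** Cantor's pairing identifies the index set with pairs (block, position), so
    it cuts the sequences in [c0] into infinitely many blocks, each of them
    infinite.  The matrix unit [(j, k)] copies block [k] of a sequence into
    block [j], keeping positions, and puts zeros elsewhere.  Such a map does not
    increase the supremum norm, and the multiplication rule is immediate because
    the pairing is a bijection.  The sum of the first [n + 1] diagonal units
    keeps the blocks up to [n]; what it discards sits at indices beyond [n],
    since an index is at least the number of its block
    ([block_le_index]), and there the entries of a null sequence are uniformly
    small: this is [block_sum].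

    The unit [(0, 0)] fixes the unit vectors of block [0], so its range, like
    the whole space, contains infinitely many unit vectors.  That this forbids
    finite dimension is the one place where linear algebra enters, and it is
    done on the dual side ([annihilating_functional]): finitely many vectors are
    always killed by some linear functional which is nonzero on a unit vector,
    hence they do not span that vector. *)

Local Open Scope R_scope.

(** * Infinite dimension from triangular functionals *)

Definition linear_functional {X : NormedModule C_AbsRing} (f : X -> C) : Prop :=
  (forall x y, f (plus x y) = Cplus (f x) (f y)) /\
  (forall a x, f (scal a x) = Cmult a (f x)).

Lemma linear_functional_sub {X : NormedModule C_AbsRing} (f g : X -> C) (t : C) :
  linear_functional f -> linear_functional g ->
  linear_functional (fun x => Cminus (f x) (Cmult t (g x))).
Proof.
  intros [fp fs] [gp gs]; split.
  - intros x y; rewrite fp, gp; ring.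
  - intros a x; rewrite fs, gs; ring.
Qed.

Lemma functional_vanishes_on_span {X : NormedModule C_AbsRing} (f : X -> C)
    (e : nat -> X) (a : nat -> C) (n : nat) :
  linear_functional f -> (forall i, (i <= n)%nat -> f (e i) = RtoC 0) ->
  f (sum_n (fun i => scal (a i) (e i)) n) = RtoC 0.
Proof.
  intros [fp fs] He; induction n as [|n IH].
  - rewrite sum_O, fs, He by lia; ring.
  - rewrite sum_Sn, fp, fs, IH by (intros; apply He; lia).
    rewrite He by lia; ring.
Qed.

(** Gaussian elimination on functionals, one vector [e n] at a time: a second
    functional, taken beyond the pivot [k] of the first, either kills [e n]
    already, or can be subtracted from the first to kill [e n] without
    disturbing the value at [b k].  The vanishing below [N] is what makes the
    second functional harmless at that pivot. *)
Lemma annihilating_functional {X : NormedModule C_AbsRing}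
    (b : nat -> X) (f : nat -> X -> C) (e : nat -> X) :
  (forall k, linear_functional (f k)) ->
  (forall k, f k (b k) <> RtoC 0) ->
  (forall k l, (l < k)%nat -> f k (b l) = RtoC 0) ->
  forall n N : nat, exists (g : X -> C) (k : nat),
    linear_functional g /\ g (b k) <> RtoC 0 /\ (N <= k)%nat /\
    (forall l, (l < N)%nat -> g (b l) = RtoC 0) /\
    (forall i, (i < n)%nat -> g (e i) = RtoC 0).
Proof.
  intros Hlin Hdiag Htri; induction n as [|n IH]; intros N.
  - exists (f N), N; repeat split; try apply Hlin; auto; intros; lia.
  - destruct (IH N) as (g & k & Lg & gk & Nk & gN & ge).
    destruct (IH (S k)) as (h & m & Lh & hm & km & hk & he).
    destruct (Ceq_dec (h (e n)) (RtoC 0)) as [h0|h0].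
    + exists h, m; split; [exact Lh|split; [exact hm|split; [lia|split]]].
      * intros l Hl; apply hk; lia.
      * intros i Hi; destruct (Nat.eq_dec i n) as [->|Hne]; [exact h0|].
        apply he; lia.
    + exists (fun x => Cminus (g x) (Cmult (Cdiv (g (e n)) (h (e n))) (h x))), k.
      split; [now apply linear_functional_sub|].
      split; [|split; [exact Nk|split]].
      * rewrite (hk k) by lia.
        intros E; apply gk; rewrite <- E; ring.
      * intros l Hl; rewrite (gN l Hl), (hk l) by lia; ring.
      * intros i Hi; destruct (Nat.eq_dec i n) as [->|Hne].
        -- field; exact h0.
        -- rewrite (ge i), (he i) by lia; ring.
Qed.

Lemma infinite_dimensional_triangular {X : NormedModule C_AbsRing}
    (S : X -> Prop) (b : nat -> X) (f : nat -> X -> C) :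
  (forall k, linear_functional (f k)) ->
  (forall k, f k (b k) <> RtoC 0) ->
  (forall k l, (l < k)%nat -> f k (b l) = RtoC 0) ->
  (forall k, S (b k)) ->
  infinite_dimensional S.
Proof.
  intros Hlin Hdiag Htri Hb (n & e & _ & Hspan).
  destruct (annihilating_functional b f e Hlin Hdiag Htri (Datatypes.S n) 0)
    as (g & k & Lg & gk & _ & _ & ge).
  destruct (Hspan (b k) (Hb k)) as [a Ha].
  apply gk; rewrite Ha; apply functional_vanishes_on_span; [exact Lg|].
  intros i Hi; apply ge; lia.
Qed.

(** * The blocks of a null sequence *)

Definition block (n : nat) : nat := fst (of_nat n).
Definition position (n : nat) : nat := snd (of_nat n).

Lemma block_to_nat (j m : nat) : block (to_nat (j, m)) = j.
Proof. unfold block; now rewrite cancel_of_to. Qed.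

Lemma position_to_nat (j m : nat) : position (to_nat (j, m)) = m.
Proof. unfold position; now rewrite cancel_of_to. Qed.

Lemma to_nat_block_position (n : nat) : to_nat (block n, position n) = n.
Proof. unfold block, position; rewrite <- surjective_pairing; apply cancel_to_of. Qed.

Lemma block_le_index (n : nat) : (block n <= n)%nat.
Proof.
  pose proof (to_nat_non_decreasing (block n) (position n)) as H.
  rewrite to_nat_block_position in H; lia.
Qed.

Lemma to_nat_lt_mono (j m M : nat) :
  (m < M)%nat -> (to_nat (j, m) < to_nat (j, M))%nat.
Proof.
  pose proof (to_nat_spec j m); pose proof (to_nat_spec j M); nia.
Qed.

Definition block_seq (j k : nat) (x : nat -> C) (n : nat) : C :=
  if Nat.eqb (block n) j then x (to_nat (k, position n)) else RtoC 0.

(** Inside block [j], an index beyond that of position [N] has position at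
    least [N], hence its source in block [k] has index at least [N]. *)
Lemma block_seq_cvg (j k : nat) (x : c0) :
  filterlim (block_seq j k x) eventually (locally (RtoC 0)).
Proof.
  apply cvg0_Cmod; intros eps.
  destruct (proj1 (cvg0_Cmod x) (c0_cvg x) eps) as [N HN].
  exists (to_nat (j, N)); intros n Hn; unfold block_seq.
  destruct (Nat.eqb_spec (block n) j) as [E|_].
  - apply HN.
    destruct (Nat.lt_ge_cases (position n) N) as [H|H].
    + apply (to_nat_lt_mono j) in H; rewrite <- E, to_nat_block_position in H.
      rewrite <- E in Hn; lia.
    + pose proof (to_nat_non_decreasing k (position n)); lia.
  - rewrite Cmod_0; apply cond_pos.
Qed.

Definition block_copy (j k : nat) (x : c0) : c0 :=
  mk_c0 (block_seq j k x) (block_seq_cvg j k x).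

Lemma block_copy_norm (j k : nat) (x : c0) : c0_norm (block_copy j k x) <= c0_norm x.
Proof.
  apply c0_norm_le; intros n; simpl; unfold block_seq.
  destruct (Nat.eqb (block n) j).
  - apply c0_norm_ge.
  - rewrite Cmod_0; apply c0_norm_ge0.
Qed.

Lemma block_copy_linear (j k : nat) :
  bounded_operator (X := c0_CompleteNormedModule) (block_copy j k).
Proof.
  split.
  - intros x y; apply c0_ext; intros n; simpl; unfold block_seq; simpl.
    destruct (Nat.eqb (block n) j); [reflexivity|ring].
  - intros a x; apply c0_ext; intros n; simpl; unfold block_seq; simpl.
    destruct (Nat.eqb (block n) j); [reflexivity|ring].
  - exists 1; split; [lra|]; intros x.
    rewrite Rmult_1_l; exact (block_copy_norm j k x).
Qed.

Lemma operator_norm_le {X : NormedModule C_AbsRing} (T : X -> X) (M : R) :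
  0 <= M -> (forall x, norm x <= 1 -> norm (T x) <= M) -> operator_norm T <= M.
Proof.
  intros HM HT; unfold operator_norm.
  set (E := fun r => exists x : X, norm x <= 1 /\ r = norm (T x)).
  destruct (Lub_Rbar_correct E) as [_ Hlub].
  assert (H : Rbar_le (Lub_Rbar E) (Finite M)).
  { apply Hlub; intros r (x & Hx & ->); exact (HT x Hx). }
  destruct (Lub_Rbar E) as [l| |]; simpl in *; tauto.
Qed.

Lemma block_copy_mult (j k l m : nat) (x : c0) :
  block_copy j k (block_copy l m x) =
  if Nat.eqb k l then block_copy j m x else c0_zero.
Proof.
  apply c0_ext; intros n.
  change (block_seq j k (block_seq l m x) n =
          (if Nat.eqb k l then block_copy j m x else c0_zero) n).
  unfold block_seq; rewrite block_to_nat, position_to_nat.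
  destruct (Nat.eqb k l); simpl; unfold block_seq;
    destruct (Nat.eqb (block n) j); reflexivity.
Qed.

Lemma block_diagonal (k : nat) (x : c0) (m : nat) :
  block_copy k k x m = if Nat.eqb (block m) k then x m else RtoC 0.
Proof.
  simpl; unfold block_seq.
  destruct (Nat.eqb_spec (block m) k) as [<-|_]; [|reflexivity].
  now rewrite to_nat_block_position.
Qed.

Lemma block_partial_sum (x : c0) (n m : nat) :
  c0_seq (sum_n (fun k => block_copy k k x) n) m =
  if Nat.leb (block m) n then x m else RtoC 0.
Proof.
  induction n as [|n IH].
  - rewrite sum_O, block_diagonal.
    destruct (Nat.eqb_spec (block m) 0), (Nat.leb_spec (block m) 0);
      reflexivity || lia.
  - rewrite sum_Sn.
    change (Cplus (c0_seq (sum_n (fun k => block_copy k k x) n) m)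
              (block_copy (S n) (S n) x m) =
            if Nat.leb (block m) (S n) then x m else RtoC 0).
    rewrite IH, block_diagonal.
    destruct (Nat.leb_spec (block m) n), (Nat.eqb_spec (block m) (S n)),
      (Nat.leb_spec (block m) (S n)); try lia; ring.
Qed.

Lemma block_sum (x : c0) :
  is_series (V := c0_CompleteNormedModule) (fun k => block_copy k k x) x.
Proof.
  intros P [eps HP].
  destruct (proj1 (cvg0_Cmod x) (c0_cvg x) (pos_div_2 eps)) as [N HN].
  exists N; intros n Hn; apply HP.
  change (c0_norm (minus (sum_n (fun k => block_copy k k x) n) x) < eps).
  (* Half of [eps]: strict coordinatewise bounds only give a weak bound on the
     supremum. *)
  apply Rle_lt_trans with (eps / 2); [|pose proof (cond_pos eps); lra].
  apply c0_norm_le; intros m.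
  change (Cmod (Cminus (c0_seq (sum_n (fun k => block_copy k k x) n) m) (x m))
          <= eps / 2).
  rewrite block_partial_sum.
  destruct (Nat.leb_spec (block m) n) as [H|H].
  - replace (Cminus (x m) (x m)) with (RtoC 0) by ring.
    rewrite Cmod_0; pose proof (cond_pos eps); lra.
  - replace (Cminus (RtoC 0) (x m)) with (Copp (x m)) by ring.
    rewrite Cmod_opp; left; apply HN; pose proof (block_le_index m); lia.
Qed.

Lemma block_matrix_units : matrix_units c0_CompleteNormedModule block_copy.
Proof.
  split.
  - apply block_copy_linear.
  - exists 1; intros r (j & k & ->); apply operator_norm_le; [lra|].
    intros x Hx; apply Rle_trans with (2 := Hx); exact (block_copy_norm j k x).
  - apply block_copy_mult.
  - apply block_sum.
Qed.

(** * Unit vectors *)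

Definition unit_seq (i n : nat) : C :=
  if Nat.eqb n i then RtoC 1 else RtoC 0.

Lemma unit_seq_cvg (i : nat) : filterlim (unit_seq i) eventually (locally (RtoC 0)).
Proof.
  apply cvg0_Cmod; intros eps; exists (S i); intros n Hn; unfold unit_seq.
  destruct (Nat.eqb_spec n i) as [E|_]; [lia|].
  rewrite Cmod_0; apply cond_pos.
Qed.

Definition unit_vector (i : nat) : c0 := mk_c0 (unit_seq i) (unit_seq_cvg i).

Lemma block_copy_unit_vector (j m : nat) :
  block_copy j j (unit_vector (to_nat (j, m))) = unit_vector (to_nat (j, m)).
Proof.
  apply c0_ext; intros n; rewrite block_diagonal.
  change (unit_vector (to_nat (j, m)) n) with (unit_seq (to_nat (j, m)) n).
  unfold unit_seq.
  destruct (Nat.eqb_spec n (to_nat (j, m))) as [->|_].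
  - now rewrite block_to_nat, Nat.eqb_refl.
  - destruct (Nat.eqb (block n) j); reflexivity.
Qed.

(** The coordinate functionals are biorthogonal to the unit vectors. *)
Lemma infinite_dimensional_unit_vectors (S : c0_CompleteNormedModule -> Prop)
    (s : nat -> nat) :
  (forall k l, s k = s l -> k = l) ->
  (forall k, S (unit_vector (s k))) ->
  infinite_dimensional S.
Proof.
  intros Hs HS.
  apply (infinite_dimensional_triangular S (fun k => unit_vector (s k))
           (fun k (x : c0) => x (s k))).
  - intros k; split; reflexivity.
  - intros k; simpl; unfold unit_seq; rewrite Nat.eqb_refl.
    intros E; apply RtoC_inj in E; lra.
  - intros k l Hl; simpl; unfold unit_seq.
    destruct (Nat.eqb_spec (s k) (s l)) as [E|_]; [|reflexivity].
    apply Hs in E; lia.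
  - exact HS.
Qed.

Theorem corollary3p6 :
  uniform_multiplicity_infinity_infinite_index c0_CompleteNormedModule.
Proof.
  split.
  - apply (infinite_dimensional_unit_vectors _ (fun k => k)); auto.
  - exists block_copy; split; [exact block_matrix_units|].
    apply (infinite_dimensional_unit_vectors _ (fun m => to_nat (0%nat, m))).
    + intros k l H; apply to_nat_inj in H; congruence.
    + intros m; exists (unit_vector (to_nat (0%nat, m))).
      now rewrite block_copy_unit_vector.
Qed.
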